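(* There exist a countable abelian group $\Gamma$ with dual $\Sigma=\widehat\Gamma$, a finite measure-preserving $\Gamma$-system $(X,\mathcal{B},\mu,T)$ (that is, $X$ is a finite set), a set $A\subseteq X$ of positive measure, and functions $\phi,\psi\in C(\Sigma)$ with $\phi\geq0$ and $\psi\geq0$ pointwise on $\Sigma$, such that $\Phi(\phi,\psi)<0$, where $\Phi$ is the bilinear form $$\Phi(\phi,\psi)=\int_\Sigma G(\phi)\cdot\psi\,d\lambda=\int_X T_\phi\big(T_\psi 1_A\cdot 1_A\big)\cdot 1_A\,d\mu$$ attached to $T$ and $A$. Consequently, the associated operator $G$ need not map non-negative functions to non-negative functions, and the bilinear form $\Phi$ need not be non-negative even when $\phi,\psi$ are.
   Context: Let $T$ be a measure-preserving action of a countable abelian group $\Gamma$ on a probability space $(X,\mathcal{B},\mu)$, with Koopman representation $T_\gamma u=u\circ T_\gamma$ on $L^2(\mu)$. Let $\Sigma=\widehat\Gamma$ and $\xi_\gamma(\chi)=\chi(\gamma)$. For $\phi\in C(\Sigma)$, $T_\phi$ is the image of $\phi$ under the unique $*$-homomorphism $C(\Sigma)\to\mathcal{L}(L^2(\mu))$ (with $\|T_\phi\|_{\mathrm{op}}\le\|\phi\|_\infty$) satisfying $T_{\xi_\gamma}=T_\gamma$. Let $A\in\mathcal{B}$ with $\delta:=\mu(A)>0$. The spectral measure $\sigma^T_{1_A}$ is the unique positive finite Borel measure on $\Sigma$ with $\langle T_\gamma 1_A,1_A\rangle=\int\xi_\gamma\,d\sigma^T_{1_A}$ for all $\gamma$,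 and $\lambda:=\frac1\delta\sigma^T_{1_A}$, a Borel probability measure. $G$ is the (unique) bounded operator on $L^2(\Sigma,\lambda)$, with $\|G\|_{\mathrm{op}}\le1$, satisfying $\int_\Sigma G(\phi)\psi\,d\lambda=\int_X T_\phi(T_\psi 1_A\cdot 1_A)\cdot 1_A\,d\mu$ for all $\phi,\psi\in C(\Sigma)$; such an operator always exists. *)

(* Defs.v *)
From HB Require Import structures.
From mathcomp Require Import all_boot all_order all_algebra.
From mathcomp Require Import all_classical all_reals all_analysis.
From mathcomp Require Import complex.

Set Implicit Arguments.
Unset Strict Implicit.
Unset Printing Implicit Defensive.

Import Order.TTheory GRing.Theory Num.Theory.
Import numFieldNormedType.Exports.

Local Open Scope classical_set_scope.
Local Open Scope ring_scope.
Local Open Scope complex_scope.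

(* Complex numbers are [R[i]]; the order on [R[i]] is the usual partial one,
   so [0 <= z] means that z is real and non-negative and [z < 0] that z is
   real and negative.  The regular structure [R[i]^o] carries the usual
   topology of the complex plane. *)

Section Dual.
Variables (R : realType) (Gam : zmodType).

(* Gam is discrete: every homomorphism to the circle is a character, and the
   compact-open topology on the dual is that of pointwise convergence. *)
Definition is_character : set {ptws Gam -> R[i]^o} :=
  [set chi | (forall a b, chi (a + b) = chi a * chi b) /\
             (forall a, `|chi a| = 1)].

Definition dual : Type := set_type is_character.

HB.instance Definition _ := Topological.on dual.

Lemma is_character1 : (fun=> 1 : R[i]^o) \in is_character.
Proof. by rewrite inE; split=> *; rewrite ?mulr1 ?normr1. Qed.

HB.instance Definition _ := isPointed.Build dual (SigSub is_character1).

Definition xi (g : Gam) (chi : dual) : R[i] := set_val chi g.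

Definition contfun : set (dual -> R[i]) :=
  [set phi | continuous (phi : dual -> R[i]^o)].

Definition sup_norm (phi : dual -> R[i]) : R :=
  sup [set complex.Re `|phi chi| | chi in [set: dual]].

Definition borel_dual : measurableType _ := g_sigma_algebraType (@open dual).

End Dual.

Section L2.
Context (R : realType) (d : measure_display) (X : measurableType d).
Variable mu : {measure set X -> \bar R}.
Implicit Types f g : X -> R[i].

Definition cmeasurable f : Prop :=
  measurable_fun setT (fun x => complex.Re (f x)) /\
  measurable_fun setT (fun x => complex.Im (f x)).

Definition cintegral f : R[i] :=
  (\int[mu]_x complex.Re (f x)) +i* (\int[mu]_x complex.Im (f x)).

Definition L2norm f : \bar R :=
  Lnorm mu 2%:E (fun x => (complex.Re `|f x|)%:E).

Definition L2 : set (X -> R[i]) :=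
  [set f | cmeasurable f /\ (L2norm f < +oo)%E].

Definition L2inner f g : R[i] := cintegral (fun x => f x * (g x)^*).

(* Elements of L^2(mu) are represented by functions and equality in L^2(mu) by
   almost everywhere equality.  A linear operator on L^2(mu) is then a map on
   functions, of which only the values on [L2] matter, compatible with that
   equality. *)
Definition L2_operator (S : (X -> R[i]) -> X -> R[i]) : Prop :=
  [/\ forall f, L2 f -> L2 (S f),
      forall f g, L2 f -> L2 g -> f = g %[ae mu] -> S f = S g %[ae mu] &
      forall (c : R[i]) f g, L2 f -> L2 g ->
        S (fun x => c * f x + g x) = (fun x => c * S f x + S g x) %[ae mu]].

Definition opnorm_le (S : (X -> R[i]) -> X -> R[i]) (M : R) : Prop :=
  forall f, L2 f -> (L2norm (S f) <= M%:E * L2norm f)%E.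

Definition positivity_preserving (S : (X -> R[i]) -> X -> R[i]) : Prop :=
  forall f, L2 f -> {ae mu, forall x, 0 <= f x} -> {ae mu, forall x, 0 <= S f x}.

End L2.

Definition cindic (R : realType) (X : Type) (A : set X) (x : X) : R[i] :=
  (\1_A x : R)%:C.

Section System.
Context (R : realType) (Gam : zmodType) (d : measure_display).
Context (X : measurableType d).
Variables (mu : probability X R) (T : Gam -> X -> X).

Definition mp_action : Prop :=
  [/\ forall x, T 0 x = x,
      forall a b x, T (a + b) x = T a (T b x),
      forall a, measurable_fun setT (T a) &
      forall a B, measurable B -> mu (T a @^-1` B) = mu B].

Definition koopman (g : Gam) (u : X -> R[i]) : X -> R[i] := u \o T g.

(* [pi phi] is the operator T_phi on L^2(mu), for phi continuous. *)
Definition is_functional_calculus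
    (pi : (dual R Gam -> R[i]) -> (X -> R[i]) -> X -> R[i]) : Prop :=
  [/\ forall phi, contfun phi ->
        L2_operator mu (pi phi) /\ opnorm_le mu (pi phi) (sup_norm phi),
      forall (c : R[i]) phi psi u, contfun phi -> contfun psi -> L2 mu u ->
        pi (fun chi => c * phi chi + psi chi) u
        = (fun x => c * pi phi u x + pi psi u x) %[ae mu],
      forall phi psi u, contfun phi -> contfun psi -> L2 mu u ->
        pi (fun chi => phi chi * psi chi) u = pi phi (pi psi u) %[ae mu],
      forall phi u v, contfun phi -> L2 mu u -> L2 mu v ->
        L2inner mu (pi phi u) v
        = L2inner mu u (pi (fun chi => (phi chi)^*) v) &
      forall g u, L2 mu u -> pi (xi g) u = koopman g u %[ae mu]].

Variable A : set X.

Definition is_spectral_measure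
    (sigma : {finite_measure set (borel_dual R Gam) -> \bar R}) : Prop :=
  forall g, L2inner mu (koopman g (cindic R A)) (cindic R A)
            = cintegral sigma (xi g).

Definition Phi (pi : (dual R Gam -> R[i]) -> (X -> R[i]) -> X -> R[i])
    (phi psi : dual R Gam -> R[i]) : R[i] :=
  cintegral mu (fun x =>
    pi phi (fun y => pi psi (cindic R A) y * cindic R A y) x * cindic R A x).

Definition is_G (pi : (dual R Gam -> R[i]) -> (X -> R[i]) -> X -> R[i])
    (lambda : probability (borel_dual R Gam) R)
    (G : (dual R Gam -> R[i]) -> dual R Gam -> R[i]) : Prop :=
  [/\ @L2_operator R _ (borel_dual R Gam) lambda G,
      @opnorm_le R _ (borel_dual R Gam) lambda G 1 &
      forall phi psi, contfun phi -> contfun psi ->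
        cintegral lambda (fun chi : borel_dual R Gam => G phi chi * psi chi)
        = Phi pi phi psi].

(* pi, sigma, lambda, G are the objects phi |-> T_phi, sigma^T_{1_A}, lambda
   and G attached to T and A. *)
Definition attached
    (pi : (dual R Gam -> R[i]) -> (X -> R[i]) -> X -> R[i])
    (sigma : {finite_measure set (borel_dual R Gam) -> \bar R})
    (lambda : probability (borel_dual R Gam) R)
    (G : (dual R Gam -> R[i]) -> dual R Gam -> R[i]) : Prop :=
  [/\ is_functional_calculus pi,
      is_spectral_measure sigma,
      forall B, measurable B ->
        lambda B = (((fine (mu A))^-1)%:E * sigma B)%E &
      is_G pi lambda G].

End System.

(* Main.v *)
(* Take Gam = X = (Z/2)^2 with the translation action, mu uniform and A the
   complement of the identity.  The Fourier coefficients of 1_A at the four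
   (real) characters are 3/4, -1/4, -1/4, -1/4, and for two characters s, t,
     Phi(delta_s, delta_t) = c_s c_t c_(s+t),
   which is negative as soon as s, t, s+t are all nontrivial.  The operator
   T_phi is a Fourier multiplier and lambda gives mass c_s^2 / mu(A) to s.
   Since c_(s+t) = [s = t] - 1/4, solving for G gives
     c_t G(phi)(t) = mu(A) (v_t - mean of v)   with v_s = c_s phi(s),
   so G is a contraction because centering does not increase l^2 norms. *)
Require Import Defs.
From HB Require Import structures.
From mathcomp Require Import all_boot all_order all_algebra.
From mathcomp Require Import all_classical all_reals all_analysis.
From mathcomp Require Import complex.
From mathcomp Require Import ring lra.
Set Implicit Arguments.
Unset Strict Implicit.
Unset Printing Implicit Defensive.

Import Order.TTheory GRing.Theory Num.Theory.
Import numFieldNormedType.Exports.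
Local Open Scope classical_set_scope.
Local Open Scope ring_scope.
Local Open Scope complex_scope.

(** * Squared modulus of complex numbers *)

Definition sqn {R : realType} (z : R[i]) : R :=
  complex.Re z ^+ 2 + complex.Im z ^+ 2.

Lemma sqn_ge0 (R : realType) (z : R[i]) : 0 <= sqn z.
Proof. by rewrite addr_ge0 ?sqr_ge0. Qed.

Lemma ReC_norm_sqn (R : realType) (z : R[i]) :
  complex.Re `|z| = Num.sqrt (sqn z).
Proof. by case: z. Qed.

(* [z^*] means [Num.conj z] in [ring_scope] and [conjc z] in [complex_scope];
   the definitions of the statement contain both. *)
Lemma num_conjE (R : realType) (z : R[i]) : Num.conj z = conjc z.
Proof. by []. Qed.

Lemma sqn_conj (R : realType) (z : R[i]) : (sqn z)%:C = z * conjc z.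
Proof.
case: z => a b; apply/eqP; rewrite eq_complex /sqn /=.
by apply/andP; split; apply/eqP; ring.
Qed.

Lemma sqnM (R : realType) (z w : R[i]) : sqn (z * w) = sqn z * sqn w.
Proof. by case: z w => [a b] [a' b']; rewrite /sqn/=; ring. Qed.

Lemma four_neq0 (R : realType) : 4 != 0 :> R[i].
Proof. by rewrite pnatr_eq0. Qed.

(** * Finite sums of weighted point masses *)

Section AtomicMeasure.
Context (R : realType) (I : finType) (d : measure_display).
Context (Y : measurableType d) (p : I -> Y) (w : I -> {nonneg R}).
Local Open Scope ereal_scope.

Definition atomic (B : set Y) : \bar R := \sum_i ((w i)%:num)%:E * \d_(p i) B.

Let atomic0 : atomic set0 = 0.
Proof. by rewrite /atomic big1// => i _; rewrite measure0 mule0. Qed.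

Let atomic_ge0 B : 0 <= atomic B.
Proof. by apply: sume_ge0 => i _; rewrite mule_ge0. Qed.

Let atomic_sigma_additive : semi_sigma_additive atomic.
Proof.
move=> F mF tF mUF; rewrite [X in _ --> X](_ : _ =
    lim ((fun n => \sum_(0 <= i < n) atomic (F i)) @ \oo)%classic).
  by apply: is_cvg_ereal_nneg_natsum => k _; exact: atomic_ge0.
rewrite nneseries_sum//; last by move=> *; rewrite mule_ge0.
apply: eq_bigr => /= i _.
exact: (measure_semi_bigcup (mscale (w i) (dirac (p i)))).
Qed.

HB.instance Definition _ := isMeasure.Build d Y R atomic
  atomic0 atomic_ge0 atomic_sigma_additive.

Let atomic_fin : fin_num_fun atomic.
Proof.
move=> U mU; rewrite (_ : atomic U = (\sum_i (w i)%:num * \1_U (p i))%:E)//.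
by rewrite -sumEFin.
Qed.

HB.instance Definition _ := Measure_isFinite.Build d Y R atomic atomic_fin.

Lemma atomic_setT : atomic setT = (\sum_i (w i)%:num)%:E.
Proof.
by rewrite /atomic -sumEFin; apply: eq_bigr => i _; rewrite diracT mule1.
Qed.

Lemma atomic_set1 i : injective p -> atomic [set p i] = ((w i)%:num)%:E.
Proof.
move=> p_inj; rewrite /atomic (bigD1 i)//= big1 ?adde0.
  by rewrite diracE mem_set// mule1.
move=> j ji; rewrite diracE memNset ?mule0//= => /p_inj ij.
by rewrite ij eqxx in ji.
Qed.

Lemma atomic_probability : (\sum_i (w i)%:num = 1)%R ->
  exists P : probability Y R, forall B, P B = atomic B.
Proof.
move=> w1; have aT : atomic setT = 1 by rewrite atomic_setT w1.
pose P : probability Y R := HB.pack atomic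
  (Measure_isProbability.Build _ _ _ atomic aT).
by exists P.
Qed.

End AtomicMeasure.

(** * Integration and L^2 on a finite space with all subsets measurable *)

Section FiniteSpace.
Context (R : realType) (I : finType) (d : measure_display).
Context (Y : measurableType d) (p : I -> Y).
Hypotheses (p_inj : injective p) (p_surj : forall y, exists i, y = p i).
Hypothesis mY : forall B : set Y, measurable B.
Variable mu : {finite_measure set Y -> \bar R}.
Local Notation wt i := (fine (mu [set p i])).

Lemma measurable_funT d' (Z : measurableType d') (f : Y -> Z) :
  measurable_fun setT f.
Proof. by move=> _ B _; exact: mY. Qed.

Lemma integral_finite (f : Y -> R) :
  (\int[mu]_x (f x)%:E = (\sum_i wt i * f (p i))%:E)%E.
Proof.
have -> : [set: Y] = \big[setU/set0]_(i <- index_enum I) [set p i].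
  apply/seteqP; split=> // y _; have [i ->] := p_surj y.
  by rewrite -bigcup_seq; exists i => //=; rewrite mem_index_enum.
rewrite integral_bigsetU_EFin ?index_enum_uniq//.
- rewrite -sumEFin; apply: eq_bigr => i _.
  rewrite (eq_integral (cst (f (p i))%:E)); last first.
    by move=> x; rewrite inE /= => ->.
  by rewrite integral_cst// EFinM fineK 1?muleC//; exact: fin_num_measure.
- by move=> i j _ _ [y [/= -> /p_inj]].
Qed.

Lemma cintegral_finite (f : Y -> R[i]) :
  cintegral mu f = \sum_i (wt i)%:C * f (p i).
Proof.
rewrite /cintegral /Rintegral !integral_finite/=; apply/eqP.
rewrite eq_complex (big_morph _ (raddfD (@complex.Re R)) erefl).
rewrite (big_morph _ (raddfD (@complex.Im R)) erefl) /=.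
by apply/andP; split; apply/eqP; apply: eq_bigr => i _; case: (f (p i)) => a b;
  rewrite /= mul0r ?subr0 ?addr0.
Qed.

Lemma L2norm_finite (f : Y -> R[i]) :
  L2norm mu f = (Num.sqrt (\sum_i wt i * sqn (f (p i))))%:E.
Proof.
rewrite /L2norm unlock /=.
rewrite (eq_integral (fun x => (sqn (f x))%:E)); last first.
  move=> x _; rewrite -[Normc.normc _]/(complex.Re `|f x|) ReC_norm_sqn.
  rewrite ger0_norm ?sqrtr_ge0//.
  by rewrite powR_mulrn ?sqrtr_ge0// sqr_sqrtr ?sqn_ge0.
rewrite integral_finite poweR_EFin powR12_sqrt// sumr_ge0// => i _.
by rewrite mulr_ge0 ?fine_ge0 ?sqn_ge0.
Qed.

Lemma L2_finite (f : Y -> R[i]) : L2 mu f.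
Proof.
split; last by rewrite L2norm_finite ltry.
by split; exact: measurable_funT.
Qed.

(** A null set cannot contain an atom of positive mass. *)
Lemma ae_finite (P : Y -> Prop) : {ae mu, forall y, P y} ->
  forall i, 0 < wt i -> P (p i).
Proof.
move=> [N [_ N0 PN]] i wt_gt0; apply: contrapT => nP.
suff wt0 : wt i = 0 by rewrite wt0 ltxx in wt_gt0.
rewrite (@subset_measure0 _ _ _ mu [set p i] N)//.
by move=> _ ->; exact: PN.
Qed.

End FiniteSpace.

(** * The Klein four-group *)

Definition klein : Type := ('Z_2 * 'Z_2)%type.

HB.instance Definition _ := GRing.Zmodule.on klein.
HB.instance Definition _ := Finite.on klein.
HB.instance Definition _ := isPointed.Build klein 0.
HB.instance Definition _ := @isMeasurable.Build default_measure_display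
  klein discrete_measurable discrete_measurable0
  discrete_measurableC discrete_measurableU.

Lemma klein_ind (P : klein -> Prop) :
  P (0, 0) -> P (0, 1) -> P (1, 0) -> P (1, 1) -> forall x, P x.
Proof.
move=> P00 P01 P10 P11 [[[|[|//]] i] [[|[|//]] j]].
- by rewrite (_ : (_, _) = (0, 0))//; congr pair; exact: val_inj.
- by rewrite (_ : (_, _) = (0, 1))//; congr pair; exact: val_inj.
- by rewrite (_ : (_, _) = (1, 0))//; congr pair; exact: val_inj.
- by rewrite (_ : (_, _) = (1, 1))//; congr pair; exact: val_inj.
Qed.

Lemma sum_klein (V : nmodType) (F : klein -> V) :
  \sum_x F x = F (0, 0) + F (0, 1) + (F (1, 0) + F (1, 1)).
Proof.
rewrite (eq_bigr (fun x => F (x.1, x.2))) => [|[]//].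
rewrite -(pair_bigA _ (fun i j => F (i, j)))/= !big_ord_recl !big_ord0 !addr0.
by congr (F _ + F _ + (F _ + F _)); congr pair; exact: val_inj.
Qed.

Definition shift (g x : klein) : klein := g + x.

(** * Fourier analysis on the Klein four-group *)

Section WalshCharacters.
Variable R : realType.
Implicit Types (s t g h x y : klein) (u v : klein -> R[i]).

(** The exponent is computed on representatives in [nat]; only its parity, the bilinear pairing of
    (Z/2)^2 with itself, matters. *)
Definition walsh s g : R[i] := (-1) ^+ (s.1 * g.1 + s.2 * g.2)%N.

Lemma walshC s g : walsh s g = walsh g s.
Proof. by rewrite /walsh mulnC [(s.2 * _)%N]mulnC. Qed.

Lemma walshD s g h : walsh s (g + h) = walsh s g * walsh s h.
Proof.
rewrite /walsh -exprD -signr_odd -[RHS]signr_odd; congr (_ ^+ nat_of_bool _).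
rewrite !oddD !oddM !odd_mod//= !oddD.
by do 6!case: (odd _).
Qed.

Lemma walsh_sqr s g : walsh s g * walsh s g = 1.
Proof. by rewrite /walsh -expr2 -exprM mulnC exprM sqrrN !expr1n. Qed.

Lemma norm_walsh s g : `|walsh s g| = 1.
Proof. by rewrite normrX normrN1 expr1n. Qed.

Lemma conj_walsh s g : (walsh s g)^* = walsh s g.
Proof. by rewrite rmorphXn rmorphN1. Qed.

Lemma sum_walsh g : \sum_s walsh s g = 4 * (g == 0)%:R.
Proof.
elim/klein_ind: g; rewrite sum_klein /walsh /= ?mul0n ?mul1n ?muln0 ?muln1 /=;
  rewrite ?addn0 ?add0n ?expr0 ?expr1; ring.
Qed.

Lemma klein_addss g : g + g = 0.
Proof. by elim/klein_ind: g; congr pair; exact: val_inj. Qed.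

(** In a group of exponent 2, x + y = 0 means x = y, so the product of the two characters sums as a
    single one. *)
Lemma walsh_orthogonal x y : \sum_s walsh s x * walsh s y = 4 * (x == y)%:R.
Proof.
under eq_bigr do rewrite -walshD; rewrite sum_walsh.
rewrite (_ : (x + y == 0) = (x == y))//.
by rewrite -[in LHS](inj_eq (addIr y)) -addrA klein_addss addr0 add0r.
Qed.

(** Unnormalised, with no conjugate since the characters are real. As [walsh] is symmetric, the same
    sum divided by 4 inverts it. *)
Definition fourier u s : R[i] := \sum_x walsh s x * u x.

Lemma fourier_inversion u x : \sum_s walsh s x * fourier u s = 4 * u x.
Proof.
rewrite /fourier; under eq_bigr do rewrite big_distrr/=.
rewrite exchange_big /= (bigD1 x)//= [X in _ + X]big1 ?addr0.
  under eq_bigr do rewrite mulrA.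
  by rewrite -big_distrl /= walsh_orthogonal eqxx mulr1.
move=> y yx; under eq_bigr do rewrite mulrA.
by rewrite -big_distrl /= walsh_orthogonal eq_sym (negbTE yx) mulr0 mul0r.
Qed.

Lemma parseval u v :
  \sum_s fourier u s * fourier v s = 4 * \sum_x u x * v x.
Proof.
transitivity (\sum_s \sum_x u x * (walsh s x * fourier v s)).
  apply: eq_bigr => s _; rewrite /fourier big_distrl/=.
  by apply: eq_bigr => x _; rewrite mulrCA mulrA.
rewrite exchange_big big_distrr/=; apply: eq_bigr => x _.
by rewrite -big_distrr/= fourier_inversion mulrCA.
Qed.

Lemma fourier_conj u s : (fourier u s)^* = fourier (fun x => (u x)^*) s.
Proof.
by rewrite rmorph_sum; apply: eq_bigr => x _; rewrite rmorphM/= conj_walsh.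
Qed.

Lemma fourier_linear (c : R[i]) u v s :
  fourier (fun x => c * u x + v x) s = c * fourier u s + fourier v s.
Proof.
rewrite /fourier big_distrr/= -big_split/=; apply: eq_bigr => x _.
by rewrite mulrDr mulrCA.
Qed.

Lemma fourier_inj u v : fourier u =1 fourier v -> u = v.
Proof.
move=> uv; apply/funext => x; apply: (mulfI (four_neq0 R)).
by rewrite -!fourier_inversion; apply: eq_bigr => s _; rewrite uv.
Qed.

Lemma fourier_shift g u s : fourier (u \o shift g) s = walsh s g * fourier u s.
Proof.
rewrite /fourier [in RHS](reindex_inj (addrI g)) big_distrr/=.
by apply: eq_bigr => x _; rewrite walshD mulrA mulrA walsh_sqr mul1r.
Qed.

(** This is the bilinear [parseval] applied to u and its conjugate, after embedding the reals in the
    complex numbers. *)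
Lemma sum_sqn_fourier u : \sum_s sqn (fourier u s) = 4 * \sum_x sqn (u x).
Proof.
apply: (@complexI R); rewrite rmorphM rmorph_nat !rmorph_sum/=.
under eq_bigr do rewrite sqn_conj fourier_conj.
by rewrite parseval; congr (_ * _); apply: eq_bigr => x _; rewrite sqn_conj.
Qed.

(** * The dual group: four characters and the discrete topology *)

Lemma walsh_is_character s : walsh s \in @is_character R klein.
Proof. by rewrite inE; split; [exact: walshD|exact: norm_walsh]. Qed.

Definition chi s : dual R klein := SigSub (walsh_is_character s).

Lemma xi_chi g s : xi g (chi s) = walsh s g.
Proof. by []. Qed.

Lemma xiD (c : dual R klein) g h : xi (g + h) c = xi g c * xi h c.
Proof. by have [+ _] := set_valP c; exact. Qed.

Lemma xi0 (c : dual R klein) : xi 0 c = 1.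
Proof.
have [_ /(_ 0) c0] := set_valP c.
have cN0 : xi 0 c != 0 by rewrite -normr_eq0 c0 oner_neq0.
by apply: (mulfI cN0); rewrite mulr1 -xiD addr0.
Qed.

Lemma xi_pm1 (c : dual R klein) g : xi g c = 1 \/ xi g c = -1.
Proof.
have /eqP : xi g c ^+ 2 = 1 by rewrite expr2 -xiD klein_addss xi0.
by rewrite sqrf_eq1 => /orP[]/eqP ->; [left|right].
Qed.

(** The elements (1, 0) and (0, 1) generate the group. *)
Lemma dual_ext (c c' : dual R klein) :
  xi (1, 0) c = xi (1, 0) c' -> xi (0, 1) c = xi (0, 1) c' -> c = c'.
Proof.
move=> e1 e2; apply: val_inj; apply/funext => g.
suff : xi g c = xi g c' by [].
elim/klein_ind: g => //.
- by rewrite !xi0.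
- rewrite (_ : (1, 1) = (1, 0) + (0, 1) :> klein) ?xiD ?e1 ?e2//.
  by congr pair; exact: val_inj.
Qed.

Lemma walsh_gen1 s : walsh s (1, 0) = (-1) ^+ s.1.
Proof. by rewrite /walsh /= muln1 muln0 addn0. Qed.

Lemma walsh_gen2 s : walsh s (0, 1) = (-1) ^+ s.2.
Proof. by rewrite /walsh /= muln1 muln0. Qed.

Lemma chi_surj (c : dual R klein) : exists s, c = chi s.
Proof.
have [c1|c1] := xi_pm1 c (1, 0); have [c2|c2] := xi_pm1 c (0, 1);
  [exists (0, 0)|exists (0, 1)|exists (1, 0)|exists (1, 1)];
  by apply: dual_ext; rewrite ?c1 ?c2 xi_chi ?walsh_gen1 ?walsh_gen2
    ?expr0 ?expr1.
Qed.

Lemma chi_inj : injective chi.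
Proof.
move=> s t st; apply/eqP; apply/negPn/negP => sNt.
(* If the characters agreed, the orthogonality sum would be 4 instead of 0. *)
have := walsh_orthogonal s t; rewrite (negbTE sNt) mulr0.
under eq_bigr do rewrite (walshC _ s) (walshC _ t) -!xi_chi st xi_chi walsh_sqr.
move=> /eqP; rewrite sumr_const card_prod !card_ord /=.
by rewrite pnatr_eq0.
Qed.

Lemma xi_continuous g : continuous (xi g : dual R klein -> R[i]^o).
Proof.
have cv : continuous (set_val : dual R klein -> {ptws klein -> R[i]^o}).
  exact: initial_continuous.
move=> c.
exact: (continuous_comp (cv c)
  (@proj_continuous _ (fun=> R[i]^o) g (set_val c))).
Qed.

(** A character is determined by its values on two generators, and these are 1 or -1. Unit balls
    around them therefore isolate it, and every set is a union of such open neighbourhoods. *)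
Lemma open_dual (B : set (dual R klein)) : open B.
Proof.
pose U g s := xi g @^-1` ball (walsh s g : R[i]^o) 1.
have oU g s : open (U g s : set (dual R klein)).
  apply: open_comp; first by move=> c _; exact: xi_continuous.
  exact: ball_open.
have U_eq g s c : U g s c -> xi g c = walsh s g.
  rewrite /U /= -ball_normE /= -xi_chi.
  (* When the signs differ, the distance is |1 + 1|, too large for a ball of radius 1. *)
  have far (z : R[i]) : 1 <= `|z + z| -> ~ (`|z + z| < 1).
    by move=> /le_gtF ->.
  have ge1 : 1 <= `|1 + 1 : R[i]| by rewrite -[1 + 1]/(2%:R) normr_nat ler1n.
  by case: (xi_pm1 (chi s) g) => ->; case: (xi_pm1 c g) => ->//;
    rewrite ?opprK => /far; [|rewrite -opprD normrN] => /(_ ge1).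
rewrite (_ : B = \bigcup_(s in chi @^-1` B) (U (1, 0) s `&` U (0, 1) s)).
  by apply: bigcup_open => s _; exact: openI.
apply/seteqP; split=> [c Bc|c [s Bs [Us1 Us2]]].
  have [s cs] := chi_surj c; exists s; first by rewrite /preimage/= -cs.
  by rewrite cs; split; exact: (@ballxx R[i] R[i]^o).
suff -> : c = chi s by [].
by apply: dual_ext; rewrite xi_chi; [exact: U_eq Us1|exact: U_eq Us2].
Qed.

Lemma contfun_dual (f : dual R klein -> R[i]) : contfun f.
Proof. by apply/continuousP => B _; exact: open_dual. Qed.

Lemma measurable_dual (B : set (borel_dual R klein)) : measurable B.
Proof. by apply: sub_sigma_algebra; exact: open_dual. Qed.

End WalshCharacters.

(** * The translation system and its functional calculus *)

Section KleinSystem.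
Context (R : realType) (mu : probability klein R).
Implicit Types (s t g x y : klein) (u v : klein -> R[i]).

Let quarter : {nonneg R} := (4^-1)%:nng.
Hypothesis muE : forall B, mu B = atomic (I := klein) id (fun=> quarter) B.

Let p_surj (x : klein) : exists i, x = id i. Proof. by exists x. Qed.

Let mK (B : set klein) : measurable B. Proof. by []. Qed.

Lemma mu_set1 x : fine (mu [set x]) = 4^-1.
Proof. by rewrite muE (atomic_set1 _ _ (@inj_id klein)). Qed.

Lemma mp_shift : mp_action mu shift.
Proof.
split=> [x|a b x|//|a B _]; rewrite /shift ?add0r ?addrA//.
rewrite !muE /atomic [RHS](reindex_inj (addrI a)).
by apply: eq_bigr => x _; rewrite !diracE.
Qed.

Lemma cintegral_klein u : cintegral mu u = 4^-1 * \sum_x u x.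
Proof.
rewrite (cintegral_finite (@inj_id klein) p_surj)//= big_distrr/=.
by apply: eq_bigr => x _; rewrite mu_set1 rmorphV ?unitfE ?pnatr_eq0//
  rmorph_nat.
Qed.

Lemma L2norm_klein u :
  L2norm mu u = (Num.sqrt (4^-1 * \sum_x sqn (u x)))%:E.
Proof.
rewrite (L2norm_finite (@inj_id klein) p_surj)//= big_distrr/=.
by congr (Num.sqrt _)%:E; apply: eq_bigr => x _; rewrite mu_set1.
Qed.

Lemma L2_klein u : L2 mu u.
Proof. exact: (L2_finite (@inj_id klein) p_surj). Qed.

(** Every point has mass 1/4, so almost everywhere means everywhere. *)
Lemma ae_klein (P : klein -> Prop) : {ae mu, forall x, P x} -> forall x, P x.
Proof.
move=> aeP x; apply: (ae_finite (I := klein) (p := id) mK aeP).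
by rewrite mu_set1 invr_gt0.
Qed.

Lemma ae_eq_klein u v : u = v %[ae mu] -> u = v.
Proof. by move=> /ae_klein uv; apply/funext => x; exact: uv. Qed.

(** The Fourier multiplier with symbol phi; the outer [fourier] with the factor 1/4 is the inverse
    transform. *)
Definition calculus (phi : dual R klein -> R[i]) u x : R[i] :=
  4^-1 * fourier (fun s => phi (chi R s) * fourier u s) x.

Lemma fourier_calculus phi u s :
  fourier (calculus phi u) s = phi (chi R s) * fourier u s.
Proof.
rewrite {1}/fourier /calculus; under eq_bigr do rewrite mulrCA.
rewrite -big_distrr/=; under eq_bigr do rewrite walshC.
by rewrite fourier_inversion mulKf.
Qed.

Lemma fourier_ae u v : fourier u =1 fourier v -> u = v %[ae mu].
Proof. by move=> /fourier_inj ->; exact: ae_eq_refl. Qed.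

Lemma sup_norm_ge (phi : dual R klein -> R[i]) s :
  Num.sqrt (sqn (phi (chi R s))) <= sup_norm phi.
Proof.
rewrite -ReC_norm_sqn; apply: ub_le_sup; last by exists (chi R s).
(* The supremum is meaningful only for a bounded set; the sum of the four moduli is an upper
   bound. *)
exists (\sum_t complex.Re `|phi (chi R t)|) => _ [c _ <-].
have [t ->] := chi_surj c; rewrite (bigD1 t)//= lerDl sumr_ge0// => i _.
by rewrite -[Normc.normc _]/(complex.Re `|phi (chi R i)|) ReC_norm_sqn sqrtr_ge0.
Qed.

Lemma calculus_opnorm phi : opnorm_le mu (calculus phi) (sup_norm phi).
Proof.
move=> u _; have M_ge0 : 0 <= sup_norm phi.
  exact: le_trans (sqrtr_ge0 _) (sup_norm_ge phi 0).
rewrite !L2norm_klein -EFinM lee_fin.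
rewrite -[in leRHS](ger0_norm M_ge0) -sqrtr_sqr -sqrtrM ?sqr_ge0//.
rewrite ler_wsqrtr// mulrCA ler_pM2l ?invr_gt0//.
rewrite -(ler_pM2l (_ : 0 < 4))// mulrCA -!sum_sqn_fourier big_distrr/=.
apply: ler_sum => s _; rewrite fourier_calculus sqnM ler_wpM2r ?sqn_ge0//.
by rewrite -[leLHS]sqr_sqrtr ?sqn_ge0// lerXn2r ?nnegrE ?sqrtr_ge0// sup_norm_ge.
Qed.

(** On the Fourier side the operator multiplies the coefficient at s by phi at [chi R s], which
    makes each axiom a pointwise identity. *)
Lemma calculus_functional : is_functional_calculus mu shift calculus.
Proof.
split=> [phi _|c phi psi u _ _ _|phi psi u _ _ _|phi u v _ _ _|g u _].
- split; last exact: calculus_opnorm.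
  split=> [u _|u v _ _ /ae_eq_klein ->|c u v _ _]; first exact: L2_klein.
    exact: ae_eq_refl.
  apply: fourier_ae => s.
  by rewrite fourier_linear !fourier_calculus fourier_linear; ring.
- apply: fourier_ae => s.
  by rewrite fourier_linear !fourier_calculus; ring.
- apply: fourier_ae => s.
  by rewrite !fourier_calculus mulrA.
- rewrite /L2inner !cintegral_klein; congr (_ * _).
  apply: (mulfI (four_neq0 R)); rewrite -!parseval; apply: eq_bigr => s _.
  rewrite -[fourier (fun x => Num.conj (v x)) s]fourier_conj.
  rewrite -[X in _ = _ * X]fourier_conj !fourier_calculus rmorphM/= conjcK.
  by ring.
- apply: fourier_ae => s.
  by rewrite fourier_shift fourier_calculus xi_chi.
Qed.

(** * The set A and its Fourier coefficients *)

Definition offzero : set klein := [set x | x != 0].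

(* The coefficients of the header are [offzero_hat s / 4]. *)
Definition offzero_hat s : R := 4 * (s == 0)%:R - 1.

Lemma cindic_offzero x : cindic R offzero x = (x != 0)%:R.
Proof.
rewrite /cindic indicE rmorph_nat; congr (nat_of_bool _)%:R.
by apply/idP/idP; rewrite inE.
Qed.

Lemma conj_cindic x : conjc (cindic R offzero x) = cindic R offzero x.
Proof. by rewrite cindic_offzero rmorph_nat. Qed.

Lemma fourier_offzero s :
  fourier (cindic R offzero) s = (offzero_hat s)%:C.
Proof.
transitivity (\sum_x walsh R x s - walsh R s 0).
  rewrite (bigD1 (0 : klein))//= walshC addrC addrK /fourier.
  rewrite (bigD1 (0 : klein))//=.
  rewrite cindic_offzero eqxx mulr0 add0r; apply: eq_bigr => x x0.
  by rewrite cindic_offzero x0 mulr1 walshC.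
by rewrite sum_walsh /offzero_hat rmorphB rmorphM !rmorph_nat /walsh !muln0.
Qed.

Lemma offzero_hat_neq0 s : offzero_hat s != 0.
Proof. by rewrite /offzero_hat; case: (s == 0) => /=; apply/eqP => ?; lra. Qed.

Lemma sum_offzero_hat_sqr : \sum_s offzero_hat s ^+ 2 = 12.
Proof. by rewrite sum_klein /offzero_hat /=; ring. Qed.

(** Multiplying by the indicator deletes only the value at 0, where all characters equal 1. *)
Lemma fourier_offzero_restrict v s :
  fourier (fun x => v x * cindic R offzero x) s = fourier v s - v 0.
Proof.
rewrite /fourier (bigD1 (0 : klein))//= [in RHS](bigD1 (0 : klein))//=.
rewrite cindic_offzero eqxx !mulr0 add0r /walsh !muln0 mul1r addrAC subrr add0r.
by apply: eq_bigr => x x0; rewrite cindic_offzero x0 mulr1.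
Qed.

Lemma mu_offzero : mu offzero = (3 / 4)%:E.
Proof.
rewrite muE /atomic; rewrite (eq_bigr (fun x => (4^-1 * (x != 0)%:R)%:E)).
  by rewrite sumEFin sum_klein /=; congr (_%:E); lra.
move=> x _; rewrite diracE EFinM; congr (_ * (nat_of_bool _)%:R%:E)%E.
by apply/idP/idP; rewrite inE.
Qed.

(** Parseval turns the integral into a sum over characters. Restricting to A subtracts the value of
    T_psi 1_A at 0, which by inversion is the mean of its Fourier coefficients. The factor 1/16
    joins the mass 1/4 of a point with the 1/4 of Parseval. *)
Lemma Phi_calculus phi psi :
  Phi mu offzero calculus phi psi =
  16^-1 * \sum_s phi (chi R s) * (offzero_hat s)%:C *
    (psi (chi R s) * (offzero_hat s)%:C
     - 4^-1 * \sum_t psi (chi R t) * (offzero_hat t)%:C).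
Proof.
rewrite /Phi cintegral_klein (_ : 16^-1 = 4^-1 * 4^-1 :> R[i]); last first.
  by rewrite -invfM -natrM.
rewrite -mulrA; congr (_ * _); apply: (mulfI (four_neq0 R)); rewrite -parseval.
rewrite mulVKf//; apply: eq_bigr => s _.
rewrite fourier_offzero !fourier_calculus fourier_offzero_restrict.
rewrite fourier_calculus fourier_offzero -!mulrA; congr (_ * _).
rewrite mulrC; congr (_ * (_ - _)); rewrite /calculus; congr (_ * _).
by apply: eq_bigr => t _; rewrite walshC /walsh !muln0 mul1r fourier_offzero.
Qed.

(** * Spectral measure and its normalisation *)

Lemma dual_weight_ge0 (k : nat) s : 0 <= offzero_hat s ^+ 2 / k%:R.
Proof. by rewrite divr_ge0 ?sqr_ge0. Qed.

Definition dual_weight k s : {nonneg R} := NngNum (dual_weight_ge0 k s).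

(** For k = 16 the masses are the squares of the coefficients [offzero_hat s / 4], giving the
    spectral measure; division by mu(A) = 3/4 leads to k = 12, giving lambda. *)
Definition dual_atomic k : set (borel_dual R klein) -> \bar R :=
  atomic (chi R : klein -> borel_dual R klein) (dual_weight k).

HB.instance Definition _ k := FiniteMeasure.on (dual_atomic k).

Lemma dual_atomic_set1 k s :
  fine (dual_atomic k [set chi R s]) = offzero_hat s ^+ 2 / k%:R.
Proof. by rewrite /dual_atomic atomic_set1//; exact: chi_inj. Qed.

Lemma dual_atomic_scale B :
  dual_atomic 12 B = (((fine (mu offzero))^-1)%:E * dual_atomic 16 B)%E.
Proof.
rewrite mu_offzero /dual_atomic /atomic ge0_sume_distrr; last first.
  by move=> s _; rewrite mule_ge0.
apply: eq_bigr => s _; rewrite muleA; congr (_ * _)%E.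
by rewrite -EFinM /=; congr (_%:E); field.
Qed.

Lemma dual_probability :
  exists P : probability (borel_dual R klein) R, forall B, P B = dual_atomic 12 B.
Proof.
apply: atomic_probability => /=.
by rewrite -big_distrl/= sum_offzero_hat_sqr divff// pnatr_eq0.
Qed.

Lemma cintegral_dual (nu : {finite_measure set (borel_dual R klein) -> \bar R})
    (f : dual R klein -> R[i]) :
  cintegral nu (f : borel_dual R klein -> R[i])
  = \sum_s (fine (nu [set chi R s]))%:C * f (chi R s).
Proof.
exact: (@cintegral_finite R klein _ (borel_dual R klein) (chi R)
  (@chi_inj R) (@chi_surj R) (@measurable_dual R)).
Qed.

Lemma spectral_dual_atomic :
  is_spectral_measure mu shift offzero (dual_atomic 16).
Proof.
move=> g; rewrite /L2inner cintegral_klein cintegral_dual.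
(* One factor 4 clears the mass of a point, the other prepares Parseval. *)
apply: (mulfI (four_neq0 R)); rewrite mulVKf//; apply: (mulfI (four_neq0 R)).
rewrite -parseval !big_distrr/=; apply: eq_bigr => s _.
rewrite [X in _ * fourier X s](_ : _ = cindic R offzero); last first.
  by apply/funext => x; rewrite num_conjE conj_cindic.
rewrite fourier_shift fourier_offzero dual_atomic_set1 xi_chi.
rewrite rmorphM rmorphXn rmorphV ?unitfE ?pnatr_eq0// rmorph_nat/=.
by field.
Qed.

(** * The operator G *)

(** The Fourier coefficient as a function of the character itself, so that [G_op] can divide by it
    without choosing an index s. *)
Definition offzero_sum (c : dual R klein) : R[i] :=
  \sum_x xi x c * cindic R offzero x.

Lemma offzero_sum_chi s : offzero_sum (chi R s) = (offzero_hat s)%:C.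
Proof. by rewrite -fourier_offzero. Qed.

Definition G_op (phi : dual R klein -> R[i]) (c : dual R klein) : R[i] :=
  (3 / 4) * (phi c - 4^-1 * (\sum_s phi (chi R s) * (offzero_hat s)%:C)
                     / offzero_sum c).

Lemma sum_sqn_center v :
  \sum_s sqn (v s - 4^-1 * \sum_t v t) <= \sum_s sqn (v s).
Proof.
rewrite -subr_ge0.
(* Centering four numbers lowers the sum of squares by four times the squared modulus of their
   mean. *)
rewrite (_ : _ - _ = 4^-1 * sqn (\sum_t v t)) ?mulr_ge0 ?sqn_ge0//.
rewrite !sum_klein.
case: (v (0, 0)) (v (0, 1)) (v (1, 0)) (v (1, 1)) => [a b] [c d] [e f] [g h].
rewrite (_ : 4^-1 = (4^-1)%:C).
  by rewrite /sqn /=; field.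
by rewrite rmorphV ?unitfE ?pnatr_eq0// rmorph_nat.
Qed.

Section OperatorG.
Variable P : probability (borel_dual R klein) R.
Hypothesis PE : forall B, P B = dual_atomic 12 B.

Let P_set1 s : fine (P [set chi R s]) = offzero_hat s ^+ 2 / 12.
Proof. by rewrite PE dual_atomic_set1. Qed.

Lemma L2_dual (f : dual R klein -> R[i]) : @L2 R _ (borel_dual R klein) P f.
Proof.
exact: (@L2_finite R klein _ (borel_dual R klein) (chi R)
  (@chi_inj R) (@chi_surj R) (@measurable_dual R)).
Qed.

(** No coefficient of A vanishes, so every character has positive mass. *)
Lemma ae_eq_dual (f g : borel_dual R klein -> R[i]) :
  f = g %[ae P] -> f = g.
Proof.
move=> fg; apply/funext => c; have [s ->] := chi_surj c.
apply: (ae_finite (p := chi R : klein -> borel_dual R klein)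
  (@measurable_dual R) fg) => //.
by rewrite P_set1 divr_gt0// exprn_even_gt0//= offzero_hat_neq0.
Qed.

Lemma G_op_is_G : is_G mu offzero calculus P G_op.
Proof.
split=> [|phi _|phi psi _ _].
- split=> [f _|f g _ _ /ae_eq_dual ->|c f g _ _]; first exact: L2_dual.
    exact: ae_eq_refl.
  rewrite (_ : G_op _ = fun e => c * G_op f e + G_op g e).
    exact: ae_eq_refl.
  apply/funext => e; rewrite /G_op.
  have -> : \sum_s (c * f (chi R s) + g (chi R s)) * (offzero_hat s)%:C =
    c * (\sum_s f (chi R s) * (offzero_hat s)%:C) +
    \sum_s g (chi R s) * (offzero_hat s)%:C.
    rewrite big_distrr -big_split/=; apply: eq_bigr => s _.
    by rewrite mulrDl mulrA.
  by rewrite !mulrDl; ring.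
- rewrite mul1e !(@L2norm_finite R klein _ (borel_dual R klein) (chi R)
  (@chi_inj R) (@chi_surj R) (@measurable_dual R)).
  rewrite lee_fin ler_wsqrtr//.
  pose v s := phi (chi R s) * (offzero_hat s)%:C.
  have sqn_real (a : R) : sqn (a%:C) = a ^+ 2 by rewrite /sqn/= expr0n addr0.
  (* The constant is (3/4)^2 from [G_op] times the 1/12 of the weights. The coefficient in the
     weight cancels the division in [G_op], leaving a centered sum; afterwards 9/16 <= 1
     suffices. *)
  apply: (@le_trans _ _ (9 / 16 / 12 * \sum_s sqn (v s))).
    apply: le_trans (ler_wpM2l _ (sum_sqn_center v)) => //.
    rewrite big_distrr/=; apply: ler_sum => s _; rewrite P_set1.
    rewrite /G_op offzero_sum_chi -/(v _).
    rewrite (_ : v s - _ =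
      (phi (chi R s) - 4^-1 * (\sum_t v t) / (offzero_hat s)%:C) *
      (offzero_hat s)%:C).
      rewrite [3 / 4](_ : _ = (3 / 4)%:C); last first.
        by rewrite rmorphM rmorphV ?unitfE ?pnatr_eq0// !rmorph_nat.
      by rewrite !sqnM !sqn_real le_eqVlt; apply/orP; left; apply/eqP; field.
    rewrite mulrBl divfK// -[0]/(0%:C) (inj_eq (@complexI R)).
    exact: offzero_hat_neq0.
  rewrite big_distrr/=; apply: ler_sum => s _; rewrite P_set1 /v sqnM sqn_real.
  have := sqn_ge0 (phi (chi R s)); have := sqr_ge0 (offzero_hat s).
  set a := _ ^+ 2; set b := sqn _ => a0 b0; nra.
- rewrite cintegral_dual Phi_calculus.
  pose m := \sum_s phi (chi R s) * (offzero_hat s)%:C.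
  pose n := \sum_s psi (chi R s) * (offzero_hat s)%:C.
  (* A common form symmetric in phi and psi; on the left 1/16 arises as 3/4 times 1/12. *)
  transitivity (16^-1 * (\sum_s phi (chi R s) * psi (chi R s) *
    (offzero_hat s)%:C ^+ 2 - 4^-1 * m * n)).
    rewrite mulrBr /n !big_distrr -sumrB/=; apply: eq_bigr => s _.
    rewrite P_set1 /G_op offzero_sum_chi -big_distrr/= -/m.
    rewrite rmorphM rmorphXn rmorphV ?unitfE ?pnatr_eq0// rmorph_nat/=.
    field; rewrite -[0]/(0%:C) (inj_eq (@complexI R)).
    exact: offzero_hat_neq0.
  congr (_ * _); under [RHS]eq_bigr do rewrite mulrBr.
  rewrite sumrB; congr (_ - _); last by rewrite -big_distrl/= -/m -/n; ring.
  by apply: eq_bigr => s _; ring.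
Qed.

End OperatorG.

(** * Existence of the attached objects, and the negative value *)

Lemma attached_exists :
  exists pi sigma lambda G, attached mu shift offzero pi sigma lambda G.
Proof.
have [P PE] := dual_probability.
exists calculus, (dual_atomic 16 : {finite_measure set _ -> \bar R}), P.
exists G_op.
split; [exact: calculus_functional|exact: spectral_dual_atomic| |].
  by move=> B _; rewrite PE dual_atomic_scale.
exact: G_op_is_G.
Qed.

(** The constant 1 is [xi 0], so linearity and the values on characters fix the result for any
    functional calculus, not just [calculus]. *)
Lemma calculus_affine pi g (e : R[i]) u :
  is_functional_calculus mu shift pi ->
  pi (fun c => 1 + e * xi g c) u = fun x => u x + e * u (g + x).
Proof.
case=> _ lin _ _ pi_xi; rewrite (_ : (fun c => _) = fun c => e * xi g c + xi 0 c).
  rewrite (ae_eq_klein (lin e (xi g) (xi 0) u _ _ _)); first 1 last.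
  - exact: contfun_dual.
  - exact: contfun_dual.
  - exact: L2_klein.
  rewrite !(ae_eq_klein (pi_xi _ _ (L2_klein u))).
  by apply/funext => x; rewrite /koopman /shift/= add0r addrC.
by apply/funext => c; rewrite xi0 addrC.
Qed.

(* Four times the delta function of the character [chi (0, 1)]. *)
Definition phi0 (c : dual R klein) : R[i] :=
  (1 + 1 * xi (1, 0) c) * (1 + (-1) * xi (0, 1) c).

(* Twice the sum of the delta functions of [chi (1, 0)] and [chi (1, 1)]. *)
Definition psi0 (c : dual R klein) : R[i] := 1 + (-1) * xi (1, 0) c.

Lemma psi0_ge0 c : 0 <= psi0 c.
Proof.
by rewrite /psi0; case: (xi_pm1 c (1, 0)) => ->;
  rewrite ?mulr1 ?subrr ?mulrNN ?mulr1 ?addr_ge0.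
Qed.

Lemma phi0_ge0 c : 0 <= phi0 c.
Proof.
by rewrite /phi0; case: (xi_pm1 c (1, 0)) => ->; case: (xi_pm1 c (0, 1)) => ->;
  rewrite ?mulrNN ?mulr1 ?mul1r ?subrr ?mul0r ?mulr0 ?mulr_ge0 ?addr_ge0.
Qed.

(** In terms of delta functions the value is 4 * 2 * 2 * (-1/4)^3: for s = (0, 1) and t = (1, 0) or
    (1, 1), all of s, t, s + t are nontrivial. The proof evaluates it by translations. *)
Lemma Phi_phi0_psi0 pi : is_functional_calculus mu shift pi ->
  Phi mu offzero pi phi0 psi0 = - 4^-1.
Proof.
move=> pi_calc; rewrite /Phi cintegral_klein /psi0 (calculus_affine _ _ _ pi_calc).
set w := (fun y => _ * _); rewrite (_ : pi phi0 w = fun x =>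
  (w x - w ((0, 1) + x)) + (w ((1, 0) + x) - w ((0, 1) + ((1, 0) + x)))).
  by rewrite sum_klein /w !cindic_offzero /=; field.
(* Multiplicativity splits [phi0] into its two affine factors, each acting as the identity plus or
   minus a translation. *)
have [_ _ mul _ _] := pi_calc.
rewrite (ae_eq_klein (mul _ _ w (@contfun_dual R (fun c => 1 + 1 * xi (1, 0) c))
  (@contfun_dual R (fun c => 1 + (-1) * xi (0, 1) c)) (L2_klein _))).
rewrite !(calculus_affine _ _ _ pi_calc); apply/funext => x.
by rewrite mul1r !mulN1r.
Qed.

Lemma cintegral_dual_ge0 (P : probability (borel_dual R klein) R)
    (f psi : dual R klein -> R[i]) :
  {ae P, forall c : borel_dual R klein, 0 <= f c} -> (forall c, 0 <= psi c) ->
  0 <= cintegral P (fun c : borel_dual R klein => f c * psi c).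
Proof.
move=> f_ge0 psi_ge0; rewrite cintegral_dual sumr_ge0// => s _.
have : 0 <= fine (P [set chi R s]) by exact: fine_ge0.
(* A null atom contributes nothing; at any other atom the almost everywhere bound holds. *)
rewrite le_eqVlt => /predU1P[<-|w_gt0]; first by rewrite mul0r.
rewrite mulr_ge0 ?ler0c ?(ltW w_gt0)// mulr_ge0//.
exact: (ae_finite (p := chi R : klein -> borel_dual R klein)
  (@measurable_dual R) f_ge0).
Qed.

End KleinSystem.

Theorem proposition4p1 (R : realType) :
  exists (Gam : zmodType) (d : measure_display) (X : measurableType d)
         (mu : probability X R) (T : Gam -> X -> X) (A : set X)
         (phi psi : dual R Gam -> R[i]),
    [/\ countable [set: Gam], finite_set [set: X], mp_action mu T,
        measurable A & (0 < mu A)%E] /\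
    [/\ contfun phi, contfun psi,
        (forall chi, 0 <= phi chi) & (forall chi, 0 <= psi chi)] /\
    (exists pi sigma lambda G, attached mu T A pi sigma lambda G) /\
    (forall pi sigma lambda G, attached mu T A pi sigma lambda G ->
      [/\ Phi mu A pi phi psi < 0,
          cintegral lambda (fun chi : borel_dual R Gam => G phi chi * psi chi)
            = Phi mu A pi phi psi,
          ~ positivity_preserving lambda G &
          ~ (forall f g : dual R Gam -> R[i], contfun f -> contfun g ->
               (forall chi, 0 <= f chi) -> (forall chi, 0 <= g chi) ->
               0 <= Phi mu A pi f g)]).
Proof.
have w1 : \sum_(x : klein) ((4^-1)%:nng : {nonneg R})%:num = 1.
  by rewrite sum_klein /=; lra.
have [mu muE] := @atomic_probability R klein _ klein id _ w1.
exists klein, _, klein, mu, shift, offzero, (@phi0 R), (@psi0 R).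
split; last split; last split.
- split=> //; last by rewrite (mu_offzero muE) lte_fin divr_gt0.
  + exact/finite_set_countable/finite_finset.
  + exact: finite_finset.
  + exact: mp_shift.
- by split; [exact: contfun_dual|exact: contfun_dual|exact: phi0_ge0|exact: psi0_ge0].
- exact: attached_exists.
move=> pi sigma lambda G [pi_calc _ _ [_ _ G_Phi]].
have GE := G_Phi _ _ (@contfun_dual R (@phi0 R)) (@contfun_dual R (@psi0 R)).
have Phi_lt0 : Phi mu offzero pi (@phi0 R) (@psi0 R) < 0.
  by rewrite (Phi_phi0_psi0 muE pi_calc) oppr_lt0 invr_gt0.
split=> // [G_pos|Phi_pos].
(* Were G positivity preserving, the integral of G(phi0) psi0 would be non-negative, yet it equals
   the negative value of Phi. *)
- have phi_ge0 : {ae lambda, forall c : borel_dual R klein, 0 <= phi0 c}.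
    by apply: aeW => c; exact: phi0_ge0.
  have Gphi_ge0 := G_pos _ (L2_dual lambda (@phi0 R)) phi_ge0.
  have := cintegral_dual_ge0 Gphi_ge0 (@psi0_ge0 R).
  by rewrite GE (lt_geF Phi_lt0).
- have := Phi_pos _ _ (@contfun_dual R (@phi0 R)) (@contfun_dual R (@psi0 R))
    (@phi0_ge0 R) (@psi0_ge0 R).
  by rewrite (lt_geF Phi_lt0).
Qed.
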